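(* Let $n\geq 1$ and let $A$ and $B$ be two $n\times n$ generalized tournament matrices. The following assertions are equivalent: (i) $A$ and $B$ have the same principal minors of orders at most $4$ (i.e. $\det A[X]=\det B[X]$ for every $X\subseteq[n]$ with $1\le |X|\le 4$); (ii) $A$ and $B$ have the same principal minors of every order (i.e. $\det A[X]=\det B[X]$ for every nonempty $X\subseteq [n]$); (iii) there exists a sequence $A_0=A, A_1,\ldots,A_m=B$ of $n\times n$ generalized tournament matrices such that for each $k=0,\ldots,m-1$, $A_{k+1}=\mathrm{Inv}(A_k,X_k)$ where $X_k$ is a clan of $A_k$.
   Context: A generalized tournament matrix of order $n$ is a real $n\times n$ matrix $M=(m_{ij})$ with nonnegative entries satisfying $M+M^{t}=J_n-I_n$, where $J_n$ is the all-ones matrix and $I_n$ the identity matrix (so $m_{ii}=0$ and $m_{ij}=1-m_{ji}\in[0,1]$ for $i\neq j$). Write $[n]=\{1,\ldots,n\}$. For nonempty $X\subseteq[n]$, $M[X]$ is the principal submatrix with rows and columns indexed by $X$. A clan of $M$ is a subset $X\subseteq[n]$ such that for all $i,j\in X$ and $k\in[n]\setminus X$, $m_{ik}=m_{jk}$ and $m_{ki}=m_{kj}$. For $Y\subseteq[n]$, $\mathrm{Inv}(M,Y)$ denotes the matrix obtained from $M$ by replacing the entry $m_{ij}$ by $m_{ji}$ for all $i,j\in Y$. *)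

(* Defs.v *)
From HB Require Import structures.
From mathcomp Require Import all_boot all_order all_algebra.
From mathcomp Require Import reals.
Set Implicit Arguments. Unset Strict Implicit. Unset Printing Implicit Defensive.
Import Order.TTheory GRing.Theory Num.Theory.
Local Open Scope ring_scope.

Definition gen_tournament (R : realType) (n : nat) (M : 'M[R]_n) : Prop :=
  (forall i j, 0 <= M i j) /\ M + M^T = const_mx 1 - 1%:M.

(* principal submatrix M[X], rows/columns indexed by X in increasing order *)
Definition psubmx (R : realType) (n : nat) (M : 'M[R]_n) (X : {set 'I_n})
  : 'M[R]_#|X| :=
  \matrix_(i < #|X|, j < #|X|) M (enum_val i) (enum_val j).

Definition is_clan (R : realType) (n : nat) (M : 'M[R]_n) (X : {set 'I_n}) : Prop :=
  forall i j k, i \in X -> j \in X -> k \notin X ->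
    M i k = M j k /\ M k i = M k j.

Definition Inv (R : realType) (n : nat) (M : 'M[R]_n) (Y : {set 'I_n}) : 'M[R]_n :=
  \matrix_(i, j) (if (i \in Y) && (j \in Y) then M j i else M i j).

(* Main.v *)
Require Import Defs.
From HB Require Import structures.
From mathcomp Require Import all_boot all_order all_fingroup all_algebra.
From mathcomp Require Import boolp reals.
From mathcomp Require Import ring lra.
Set Implicit Arguments. Unset Strict Implicit. Unset Printing Implicit Defensive.
Import Order.TTheory GRing.Theory Num.Theory.
Local Open Scope ring_scope.

(** (iii) => (ii): with respect to a clan and its complement, a matrix is a
    block matrix [P, 1 v; w 1, Q], and the Schur complement
    P - 1 v Q^-1 w 1 differs from P by a multiple of the all-ones matrix, so
    transposing P does not change the determinant.

    (i) => (iii): put s = A - A^T.  Minors of order 2 give B i j = A i j or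
    A j i, so every pair with s <> 0 is either reversed (R) or unreversed (E).
    Minors of order 3 forbid triangles with one R pair, one E pair and one pair
    with s = 0, and give s x y = s x z whenever xy, xz have one colour and yz
    the other.  Hence the R-components and the E-components are clans of A.
    By induction on the size of a clan X one makes A agree with B on X by
    inversions inside X: if X is not R-connected, work in a smaller clan; if it
    is not E-connected, invert X first.  If it is both, X contains an
    alternating 4-path, where the minors of order 4 equalise |s| on the two
    colours.  Gallai's forcing classes of the edges of this path span X (or
    give a smaller clan with an R pair), and a version of Gallai's triangle
    lemma shows that the spanning classes orient X as a strict weak order, in
    which final sections are clans; one of them is proper and has an R pair. *)

(** * Two-coloured skew functions and Gallai forcing *)

(** The two colours play symmetric roles ([bicolored_swap]); pairs without
    colour are those with [s x y = 0]. *)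
Record bicolored (K : realDomainType) (T : finType) (s : T -> T -> K)
    (R E : rel T) : Prop := Bicolored {
  skew : forall x y, s x y = - s y x;
  symR : symmetric R;
  symE : symmetric E;
  disjRE : forall x y, R x y -> ~~ E x y;
  neq0R : forall x y, R x y -> s x y != 0;
  neq0E : forall x y, E x y -> s x y != 0;
  eq0N : forall x y, ~~ R x y -> ~~ E x y -> s x y = 0;
  norainbow : forall x y z, R x y -> E x z -> R y z || E y z;
  apexR : forall x y z, R x y -> R x z -> E y z -> s x y = s x z;
  apexE : forall x y z, E x y -> E x z -> R y z -> s x y = s x z;
  p4_sqr : forall x y z t, R x y -> R y z -> R z t ->
    E x z -> E x t -> E y t -> s x y ^+ 2 = s x z ^+ 2 }.

(** Connectivity of the graph [R] on [W], stated by cuts instead of paths: the arguments below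
    choose a cut and take an edge across it. *)
Definition cut_connected (T : finType) (R : rel T) (W : {set T}) :=
  forall U : {set T}, U \subset W -> U != set0 -> U != W ->
  exists x y, [/\ x \in U, y \in W :\: U & R x y].

(** Only values seen from outside [Y] are constrained; for a skew [s] the transposed condition
    follows. *)
Definition s_clan (K : realDomainType) (T : finType) (s : T -> T -> K)
    (Y : {set T}) :=
  forall k x y, k \notin Y -> x \in Y -> y \in Y -> s k x = s k y.

(** Gallai's forcing relation: two R-edges sharing an endpoint force each
    other when their other endpoints are joined by an E-edge; [apexR] then
    says that forcing preserves the value of [s]. *)
Inductive forced (T : finType) (R E : rel T) (x z : T) : T -> T -> Prop :=
| forced_refl : forced R E x z x z
| forced_r u v v' : forced R E x z u v -> R u v' -> E v v' -> forced R E x z u v'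
| forced_l u u' v : forced R E x z u v -> R u' v -> E u u' -> forced R E x z u' v.

Definition spanning (T : finType) (R E : rel T) (x z : T) :=
  forall k, exists w, forced R E x z k w \/ forced R E x z w k.

(** An R-path [a b c d] whose other three pairs form the E-path [b d a c]. *)
Definition p4 (T : finType) (R E : rel T) (a b c d : T) :=
  [/\ R a b, R b c & R c d] /\ [/\ E a c, E a d & E b d].

(** * Exchange of colours and calculus of forcing *)

Section Colored.
Variables (K : realDomainType) (T : finType) (s : T -> T -> K) (R E : rel T).
Hypothesis H : bicolored s R E.

Lemma s_xx x : s x x = 0.
Proof.
have /eqP := skew H x x; rewrite -subr_eq0 opprK -mulr2n mulrn_eq0 /= => /eqP; exact.
Qed.

Lemma E_irr x : E x x = false.
Proof. by apply/negP => /(neq0E H); rewrite s_xx eqxx. Qed.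

(** The complementary R-path [z x t y] gives [s z x] and [s z t] equal squares; [apexE] at [z], then
    at [y], carries the square from [z t] along the E-path back to [x y]. *)
Lemma p4_sqr_swap x y z t : E x y -> E y z -> E z t ->
  R x z -> R x t -> R y t -> s x y ^+ 2 = s x z ^+ 2.
Proof.
move=> Exy Eyz Ezt Rxz Rxt Ryt.
have [Rzx Rty Eyx] : [/\ R z x, R t y & E y x].
  by rewrite (symR H) (symR H t) (symE H).
have Etz : E t z by rewrite (symE H).
have := p4_sqr H Rzx Rxt Rty Ezt; rewrite (symE H) => /(_ Eyz Exy).
rewrite (skew H z x) sqrrN => ->.
by rewrite -(apexE H (_ : E z y) Ezt Ryt) 1?(symE H) // (skew H z) sqrrN
   -(apexE H Eyx Eyz Rxz) (skew H y) sqrrN.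
Qed.

Lemma bicolored_swap : bicolored s E R.
Proof.
case: (H) => h1 h2 h3 h4 h5 h6 h7 h8 h9 h10 h11; split => //.
- by move=> x y Exy; apply/negP => /h4; rewrite Exy.
- by move=> x y nE nR; apply: h7.
- by move=> x y z Exy Rxz; rewrite orbC h3 h2; apply: (h8 x).
- exact: p4_sqr_swap.
Qed.

Lemma p4_swap a b c d : p4 R E a b c d -> p4 E R b d a c.
Proof.
case=> [[Rab Rbc Rcd] [Eac Ead Ebd]]; split; split => //.
- by rewrite (symE H).
- by rewrite (symR H).
- by rewrite (symR H).
Qed.

(** If [s k] took two values on [W], an R-edge [u v] would join a level set to the rest. If [k u]
    and [k v] are both E, [apexE] equates the values; if just one is, the triangle is rainbow; if
    neither is, both values vanish. *)
Lemma cut_connected_const (W : {set T}) k : cut_connected R W ->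
  (forall x, x \in W -> ~~ R k x) ->
  forall x y, x \in W -> y \in W -> s k x = s k y.
Proof.
move=> conW nR x y xW yW; apply/eqP/negPn/negP => ne.
have [||| u [v []]] := conW [set u in W | s k u == s k x].
- by apply/subsetP => u; rewrite inE => /andP[].
- by apply/set0Pn; exists x; rewrite inE xW eqxx.
- by apply/eqP => /setP /(_ y); rewrite inE yW eq_sym (negPf ne).
rewrite !inE => /andP[uW /eqP eu] /andP[+ vW]; rewrite vW /= -eu => nev Ruv.
case Eku : (E k u); case Ekv: (E k v).
- by rewrite (apexE H Eku Ekv Ruv) eqxx in nev.
- have Euk : E u k by rewrite (symE H).
  by have := norainbow H Ruv Euk; rewrite (symR H) (symE H) Ekv (negPf (nR v vW)).
- have Evk : E v k by rewrite (symE H).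
  have Rvu : R v u by rewrite (symR H).
  by have := norainbow H Rvu Evk; rewrite (symR H) (symE H) Eku (negPf (nR u uW)).
- by rewrite !(eq0N H) ?nR ?Eku ?Ekv ?eqxx in nev.
Qed.

Lemma forcedR x z u v : R x z -> forced R E x z u v -> R u v.
Proof. by move=> Rxz; case. Qed.

Lemma forced_trans x z u v p q : forced R E x z u v -> forced R E u v p q ->
  forced R E x z p q.
Proof.
move=> xzuv; elim=> [//|p' q1 q2 _ IH|p1 p2 q' _ IH]; [exact: forced_r IH|exact: forced_l IH].
Qed.

Lemma forced_sym x z u v : R x z -> forced R E x z u v -> forced R E u v x z.
Proof.
move=> Rxz; elim=> [|{}u {}v v' F IH Ruv' Evv'|{}u u' {}v F IH Ru'v Euu'].
- exact: forced_refl.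
- apply: forced_trans IH; apply: forced_r (forced_refl _ _ _ _) _ _.
    exact: forcedR F.
  by rewrite (symE H).
- apply: forced_trans IH; apply: forced_l (forced_refl _ _ _ _) _ _.
    exact: forcedR F.
  by rewrite (symE H).
Qed.

Lemma forced_rev x z u v : forced R E x z u v -> forced R E z x v u.
Proof.
elim=> [|{}u {}v v' F IH Ruv' Evv'|{}u u' {}v F IH Ru'v Euu'].
- exact: forced_refl.
- by apply: forced_l IH _ Evv'; rewrite (symR H).
- by apply: forced_r IH _ Euu'; rewrite (symR H).
Qed.

Lemma forced_s x z u v : R x z -> forced R E x z u v -> s u v = s x z.
Proof.
move=> Rxz; elim=> [//|{}u {}v v' F <- Ruv' Evv'|{}u u' {}v F <- Ru'v Euu'].
  by rewrite (apexR H (forcedR Rxz F) Ruv' Evv').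
rewrite (skew H u') (skew H u); congr (- _); apply/esym.
by apply: (apexR H _ _ Euu'); rewrite (symR H) // (forcedR Rxz F).
Qed.

Lemma spanning_forced x z u v : R x z -> forced R E x z u v ->
  spanning R E x z -> spanning R E u v.
Proof.
move=> Rxz F sp k; have [w [G|G]] := sp k; exists w; [left|right];
exact: forced_trans (forced_sym Rxz F) G.
Qed.

Lemma spanning_rev x z : spanning R E x z -> spanning R E z x.
Proof.
by move=> sp k; have [w [G|G]] := sp k; exists w; [right|left]; apply: forced_rev.
Qed.

(** * Supports of forcing classes *)

Definition support x z :=
  [set k | `[< exists w, forced R E x z k w \/ forced R E x z w k >]].

Lemma in_supportl x z u v : forced R E x z u v -> u \in support x z.
Proof. by move=> F; rewrite inE; apply/asboolP; exists v; left. Qed.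

Lemma in_supportr x z u v : forced R E x z u v -> v \in support x z.
Proof. by move=> F; rewrite inE; apply/asboolP; exists u; right. Qed.

Lemma supportP x z k : k \in support x z ->
  exists w, forced R E x z k w \/ forced R E x z w k.
Proof. by rewrite inE => /asboolP. Qed.

(** If [k] is E-joined to just one end of a forced edge [u v], then by [norainbow] it is R-joined to
    the other, and this R-edge is forced by [u v], putting [k] in the support. So E-adjacency to [k]
    agrees at both ends, and it propagates because successive forced edges share an end. *)
Lemma support_homogeneous x z k : R x z -> k \notin support x z ->
  forall u v, forced R E x z u v -> (E k u = E k x) /\ (E k v = E k x).
Proof.
move=> Rxz kV.
have step u v : forced R E x z u v -> E k u = E k v.
  move=> F; have Ruv := forcedR Rxz F; apply/idP/idP => Ek.
  - have Euk : E u k by rewrite (symE H).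
    have := norainbow H Ruv Euk; rewrite (symE H v) => /orP[Rvk|//].
    have G : forced R E x z k v by apply: forced_l F _ Euk; rewrite (symR H).
    by rewrite (in_supportl G) in kV.
  - have Evk : E v k by rewrite (symE H).
    have Rvu : R v u by rewrite (symR H).
    have := norainbow H Rvu Evk; rewrite (symE H u) => /orP[Ruk|//].
    by have G := forced_r F Ruk Evk; rewrite (in_supportr G) in kV.
move=> u v; elim=> [|{}u {}v v' F [IH1 IH2] Ruv' Evv'|{}u u' {}v F [IH1 IH2] Ru'v Euu'].
- by rewrite -(step _ _ (forced_refl _ _ _ _)).
- by rewrite -(step _ _ (forced_r F Ruv' Evv')).
- by rewrite (step _ _ (forced_l F Ru'v Euu')).
Qed.

(** Successive edges of a forcing chain share an end, so a set with no R-edge across it contains all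
    vertices of the class or none. *)
Lemma support_connected x z : R x z -> cut_connected R (support x z).
Proof.
move=> Rxz U sU U0 UV; apply: contrapT => /forallNP nex.
have nR u v : u \in U -> v \in support x z -> v \notin U -> ~~ R u v.
  move=> uU vV vU; apply/negP => Ruv; apply: (nex u); exists v; split => //.
  by rewrite in_setD vU vV.
have step u v : forced R E x z u v -> (u \in U) = (v \in U).
  move=> F; have Ruv := forcedR Rxz F; apply/idP/idP => uU; apply/negPn/negP => vU.
    by move: (nR _ _ uU (in_supportr F) vU); rewrite Ruv.
  by move: (nR _ _ uU (in_supportl F) vU); rewrite (symR H) Ruv.
have inv u v : forced R E x z u v -> (u \in U) = (x \in U) /\ (v \in U) = (x \in U).
  elim=> [|{}u {}v v' F [IH1 IH2] Ruv' Evv'|{}u u' {}v F [IH1 IH2] Ru'v Euu'].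
  - by rewrite -(step _ _ (forced_refl _ _ _ _)).
  - by rewrite -(step _ _ (forced_r F Ruv' Evv')).
  - by rewrite (step _ _ (forced_l F Ru'v Euu')).
have all k : k \in support x z -> (k \in U) = (x \in U).
  by move=> /supportP[w [/inv[]|/inv[]]].
case xU : (x \in U).
  case/eqP: UV; apply/eqP; rewrite eqEsubset sU; apply/subsetP => k /all ->.
  by [].
case/set0Pn: U0 => k kU; have := all k (subsetP sU k kU); by rewrite kU xU.
Qed.

(** Each forcing step moves one end along an E-edge, so the first ends are E-connected, and so are
    the second ends. The two groups are joined through [d], which is E-adjacent to [a] and [b] and
    belongs to the support: [b a] forces [b c], which forces [d c]. *)
Lemma support_connected_swap a b c d : p4 R E a b c d ->
  cut_connected E (support b a).
Proof.
move=> [[Rab Rbc Rcd] [Eac Ead Ebd]] U sU U0 UV; apply: contrapT => /forallNP nex.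
have Rba : R b a by rewrite (symR H).
have nE u v : u \in support b a -> v \in support b a -> E u v -> (u \in U) = (v \in U).
  have aux u' v' : u' \in U -> v' \in support b a -> v' \notin U -> ~~ E u' v'.
    move=> uU vV vU; apply/negP => Euv; apply: (nex u'); exists v'; split => //.
    by rewrite in_setD vU vV.
  move=> uV vV Euv; apply/idP/idP => uU; apply/negPn/negP => vU.
    by move: (aux _ _ uU vV vU); rewrite Euv.
  by move: (aux _ _ uU uV vU); rewrite (symE H) Euv.
have F1 : forced R E b a b c := forced_r (forced_refl _ _ _ _) Rbc Eac.
have F2 : forced R E b a d c by apply: forced_l F1 _ Ebd; rewrite (symR H).
have F0 := forced_refl R E b a.
have ab : (a \in U) = (b \in U).
  rewrite (nE _ _ (in_supportr F0) (in_supportl F2) Ead).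
  by rewrite (nE _ _ (in_supportl F0) (in_supportl F2) Ebd).
have inv u v : forced R E b a u v -> (u \in U) = (b \in U) /\ (v \in U) = (b \in U).
  elim=> [//|{}u {}v v' F [IH1 IH2] Ruv' Evv'|{}u u' {}v F [IH1 IH2] Ru'v Euu'].
  - by rewrite -(nE _ _ (in_supportr F) (in_supportr (forced_r F Ruv' Evv')) Evv').
  - by rewrite -(nE _ _ (in_supportl F) (in_supportl (forced_l F Ru'v Euu')) Euu').
have all k : k \in support b a -> (k \in U) = (b \in U).
  by move=> /supportP[w [/inv[]|/inv[]]].
case xU : (b \in U).
  by case/eqP: UV; apply/eqP; rewrite eqEsubset sU; apply/subsetP => k /all ->.
by case/set0Pn: U0 => k kU; have := all k (subsetP sU k kU); rewrite kU xU.
Qed.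

(** * Consequences of a spanning forcing class *)

(** Gallai's triangle lemma: if it fails for [a], the failure propagates along
    forcing, so that no forced edge has [a] as an endpoint. *)
Lemma forced_triangle a x z : R x z -> spanning R E x z -> ~~ E x a -> ~~ E a z ->
  forced R E x z x a \/ forced R E x z a z.
Proof.
move=> Rxz sp nExa nEaz; apply: contrapT => /not_orP[nxa naz].
have inv u v : forced R E x z u v -> [/\ ~~ E u a, ~~ E a v,
    ~ forced R E x z u a & ~ forced R E x z a v].
  elim=> [|{}u {}v v' F [h1 h2 h3 h4] Ruv' Evv'|{}u u' {}v F [h1 h2 h3 h4] Ru'v Euu'].
  - by split.
  - have F' := forced_r F Ruv' Evv'.
    have Rv'u : R v' u by rewrite (symR H).
    have Ev'v : E v' v by rewrite (symE H).
    split=> //; first apply/negP => Eav'.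
      have Ev'a : E v' a by rewrite (symE H).
      have := norainbow H Rv'u Ev'a; rewrite (negPf h1) orbF => Rua.
      exact/h3/(forced_r F' Rua Ev'a).
    move=> G; have Rv'a : R v' a by rewrite (symR H) (forcedR Rxz G).
    have := norainbow H Rv'a Ev'v; rewrite (negPf h2) orbF => Rav.
    exact/h4/(forced_r G Rav Ev'v).
  - have F' := forced_l F Ru'v Euu'.
    have Eu'u : E u' u by rewrite (symE H).
    split=> //; first apply/negP => Eu'a.
      have := norainbow H Ru'v Eu'a; rewrite (symE H v) (negPf h2) orbF => Rva.
      by apply/h4/(forced_l F' _ Eu'a); rewrite (symR H).
    move=> G; have Ru'a := forcedR Rxz G.
    have := norainbow H Ru'a Eu'u; rewrite (symE H a) (negPf h1) orbF => Rau.
    by apply/h3/(forced_l G _ Eu'u); rewrite (symR H).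
by have [w [F|F]] := sp a; have [_ _ h3 h4] := inv _ _ F.
Qed.

(** The first forced edge along which [y] stops being E-adjacent to both
    endpoints yields an alternating 4-path. *)
Lemma forced_p4 y x z : R x z -> spanning R E x z -> E y x -> E y z ->
  exists b c d, [/\ p4 R E y b c d, forced E R y x y c & s y b ^+ 2 = s x z ^+ 2].
Proof.
move=> Rxz sp Eyx Eyz; apply: contrapT => nex.
have inv u v : forced R E x z u v -> [/\ E y u, E y v,
    forced E R y x y u & forced E R y x y v].
  elim=> [|{}u {}v v' F [h1 h2 h3 h4] Ruv' Evv'|{}u u' {}v F [h1 h2 h3 h4] Ru'v Euu'].
  - by split=> //; [exact: forced_refl|apply: forced_r (forced_refl _ _ _ _) _ _].
  - have F' := forced_r F Ruv' Evv'.
    have Euy : E u y by rewrite (symE H).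
    have Rv'u : R v' u by rewrite (symR H).
    have := norainbow H Ruv' Euy => /orP[Rv'y|Ev'y].
      have Ryv' : R y v' by rewrite (symR H).
      case: nex; exists v', u, v; split=> //.
        by split; split=> //; [exact: forcedR F|rewrite (symE H)].
      by rewrite -(forced_s Rxz F') (skew H y) (skew H u) (apexR H Rv'y Rv'u h1).
    have Eyv' : E y v' by rewrite (symE H).
    by split=> //; apply: forced_r h3 Eyv' Ruv'.
  - have F' := forced_l F Ru'v Euu'.
    have Evy : E v y by rewrite (symE H).
    have Rvu' : R v u' by rewrite (symR H).
    have := norainbow H Rvu' Evy => /orP[Ru'y|Eu'y].
      have Ryu' : R y u' by rewrite (symR H).
      case: nex; exists u', v, u; split=> //.
        by split; split=> //; [rewrite (symR H) (forcedR Rxz F)|rewrite (symE H)].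
      by rewrite -(forced_s Rxz F') (skew H y) sqrrN (apexR H Ru'y Ru'v h2).
    have Eyu' : E y u' by rewrite (symE H).
    by split=> //; apply: forced_r h4 Eyu' Rvu'.
by have [w [F|F]] := sp y; have [] := inv _ _ F; rewrite E_irr.
Qed.

End Colored.

(** An outside vertex [k] is E-joined to the whole support or to none of it. In the first case it
    sends no R-edge there and R-connectedness makes [s k] constant; in the second, E-connectedness
    does. *)
Lemma s_clan_support (K : realDomainType) (T : finType) (s : T -> T -> K)
    (R E : rel T) (H : bicolored s R E) a b c d :
  p4 R E a b c d -> s_clan s (support R E b a).
Proof.
move=> P k x y kV xV yV.
have Rba : R b a by case: P => [[Rab _ _] _]; rewrite (symR H).
have hom := support_homogeneous H Rba kV.
have hE w : w \in support R E b a -> E k w = E k b.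
  by move=> /supportP[w' [/hom[]|/hom[]]].
have [Ekb|nEkb] := boolP (E k b).
  apply: (cut_connected_const H (support_connected H Rba)) => // w /hE.
  by rewrite Ekb => /(disjRE (bicolored_swap H)).
apply: (cut_connected_const (bicolored_swap H) (support_connected_swap H P)) => //.
by move=> w /hE ->.
Qed.

(** * Existence of an alternating 4-path *)

Section ExistsP4.
Variables (K : realDomainType) (T : finType) (s : T -> T -> K) (R E : rel T).
Hypothesis H : bicolored s R E.

(** The path is [v q x p]. The E-edge [q p] inside [U] leaves the R-neighbours of [v], so
    [norainbow] makes [v p] an E-edge. The vertex [x] of [U'] is E-joined to [v], the only exit from
    [U']. As no E-edge joins [U] to [U'], [norainbow] gives the R-edges [q x] and [x p]. *)
Lemma p4_of_cut (W U U' : {set T}) v u w : cut_connected E W ->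
  v \in W -> W :\ v = U :|: U' -> (forall x y, x \in U -> y \in U' -> ~~ E x y) ->
  u \in U -> w \in U' -> R v u -> exists a b c d, p4 R E a b c d.
Proof.
move=> conE vW UU' nE uU wU' Rvu.
have sU x : x \in U -> x \in W /\ x != v.
  move=> xU; have : x \in W :\ v by rewrite UU' inE xU.
  by rewrite !inE => /andP[].
have sU' x : x \in U' -> x \in W /\ x != v.
  move=> xU; have : x \in W :\ v by rewrite UU' inE xU orbT.
  by rewrite !inE => /andP[].
have cover x : x \in W -> [|| x == v, x \in U | x \in U'].
  move=> xW; have : x \in W :\ v = (x \in U :|: U') by rewrite UU'.
  by rewrite !inE xW andbT => <-; case: eqP.
have [||| q [p [+ + Eqp]]] := conE [set q in U | R v q].
- by apply/subsetP => x; rewrite inE => /andP[/sU[]].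
- by apply/set0Pn; exists u; rewrite inE uU.
- apply/eqP => /setP /(_ v); rewrite vW inE => /andP[/sU[_]]; by rewrite eqxx.
rewrite !inE => /andP[qU Rvq] /andP[nQp pW].
have pv : p != v.
  apply/eqP => pv; have := disjRE H Rvq; by rewrite (symE H) -pv Eqp.
have pU : p \in U.
  have := cover p pW; rewrite (negPf pv) /= => /orP[//|pU'].
  by have := nE _ _ qU pU'; rewrite Eqp.
rewrite pU /= in nQp.
have Rqv : R q v by rewrite (symR H).
have Evp : E v p.
  by have := norainbow H Rqv Eqp; rewrite (negPf nQp).
have [||| x [y [xU']]] := conE U'.
- by apply/subsetP => x /sU'[].
- by apply/set0Pn; exists w.
- by apply/eqP => U'W; have := sU' v; rewrite U'W eqxx => /(_ vW)[].
rewrite inE => /andP[yU' yW] Exy.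
have yv : y = v.
  have := cover y yW; rewrite (negPf yU') orbF => /orP[/eqP //|yU].
  by have := nE _ _ yU xU'; rewrite (symE H) Exy.
rewrite {}yv in Exy.
have Evx : E v x by rewrite (symE H).
have Rqx : R q x.
  by have := norainbow H Rvq Evx; rewrite (negPf (nE _ _ qU xU')) orbF.
have Rxq : R x q by rewrite (symR H).
have Rxp : R x p.
  by have := norainbow H Rqx Eqp; rewrite (symE H x) (negPf (nE _ _ pU xU')) orbF.
by exists v, q, x, p; split; split.
Qed.

Lemma cut_connected1 (W : {set T}) v : v \in W -> (1 < #|W|)%N ->
  cut_connected R W -> exists2 u, u \in W :\ v & R v u.
Proof.
move=> vW W1 conR; have [||| x [y []]] := conR [set v].
- by rewrite sub1set.
- by apply/set0Pn; exists v; rewrite inE.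
- by apply/eqP => Wv; rewrite -Wv cards1 in W1.
by rewrite inE => /eqP -> yW Rvy; exists y.
Qed.

(** Here [v] is a cut vertex for E. It has an R-neighbour, and the side containing that neighbour
    plays the role of [U] in [p4_of_cut]. *)
Lemma p4_of_disconnected (W : {set T}) v : v \in W -> (1 < #|W|)%N ->
  cut_connected R W -> cut_connected E W -> ~ cut_connected E (W :\ v) ->
  exists a b c d, p4 R E a b c d.
Proof.
move=> vW W1 conR conE /existsNP[U] /not_implyP[sU] /not_implyP[/set0Pn[x xU]].
move=> /not_implyP[UW /forallNP nex].
have nE p q : p \in U -> q \in (W :\ v) :\: U -> ~~ E p q.
  by move=> pU qU; apply/negP => Epq; apply: (nex p); exists q.
have [y yU] : exists y, y \in (W :\ v) :\: U.
  by apply/set0Pn; rewrite setD_eq0; apply: contra UW => sWU; rewrite eqEsubset sU.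
have cover : W :\ v = U :|: (W :\ v) :\: U by rewrite -{1}(setID (W :\ v) U) (setIidPr sU).
have [u uW Rvu] := cut_connected1 vW W1 conR.
move: (uW); rewrite {1}cover inE => /orP[uU|uU].
  exact: (p4_of_cut conE vW cover nE uU yU Rvu).
rewrite setUC in cover.
apply: (p4_of_cut conE vW cover _ uU xU Rvu) => p q pU qU.
by rewrite (symE H) nE.
Qed.

End ExistsP4.

(** Analogue of the theorem that a graph with no induced 4-path is disconnected or has a
    disconnected complement. Vertices are deleted while both colours stay connected; otherwise the
    deleted vertex is a cut vertex of one colour. A set of two vertices cannot be connected in both
    colours. *)
Lemma exists_p4 (K : realDomainType) (T : finType) (s : T -> T -> K)
    (R E : rel T) (H : bicolored s R E) (W : {set T}) : (1 < #|W|)%N ->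
  cut_connected R W -> cut_connected E W -> exists a b c d, p4 R E a b c d.
Proof.
have [m] := ubnP #|W|; elim: m W => // m IH W; rewrite ltnS => Wm W1 conR conE.
have [v vW] : exists v, v \in W by apply/set0Pn; rewrite -card_gt0 ltnW.
have cardW := cardsD1 v W; rewrite vW in cardW.
have [W'1|W'1] := leqP #|W :\ v| 1.
  have [u uW Rvu] := cut_connected1 vW W1 conR.
  have [w wW Evw] := cut_connected1 vW W1 conE.
  have /card_le1_eqP /(_ _ _ uW wW) uw := W'1.
  by have := disjRE H Rvu; rewrite -uw Evw.
have [conE'|nconE'] := pselect (cut_connected E (W :\ v)); last first.
  exact: (p4_of_disconnected H vW W1 conR conE nconE').
have [conR'|nconR'] := pselect (cut_connected R (W :\ v)); last first.
  have [a [b [c [d P]]]] := p4_of_disconnected (bicolored_swap H) vW W1 conE conR nconR'.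
  by exists b, d, a, c; apply: (p4_swap (bicolored_swap H)).
by apply: IH conR' conE' => //; apply: leq_trans Wm; rewrite cardW.
Qed.

(** * The weak order and its proper clans *)

(** The second hypothesis is negative transitivity: from [L k q] and not [L w q] it yields [L k w],
    hence [s k w = a] for every [w] in the section. *)
Lemma final_section_clan (K : realDomainType) (T : finType) (s : T -> T -> K)
    (L : rel T) a q :
  (forall x y, L x y -> s x y = a) ->
  (forall x z y, L x z -> L x y \/ L y z) ->
  s_clan s [set k | ~~ L k q].
Proof.
move=> Ls Lw k x y; rewrite !inE negbK => Lkq nx ny.
have aux w : ~~ L w q -> s k w = a.
  by move=> nw; case: (Lw _ _ w Lkq) => [/Ls //|]; rewrite (negPf nw).
by rewrite !aux.
Qed.

Definition spanning_pair (T : finType) (R E : rel T) (x y : T) :=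
  R x y /\ spanning R E x y \/ E x y /\ spanning E R x y.

(** Negative transitivity, by the number of E-edges from [y] to [x] and [z]. With none, the triangle
    lemma applies; with one, the remaining pair is R and is forced by [x z]; with two, a 4-path
    starting at [y] transfers spanning and the square of [s] to the colour E. *)
Lemma spanning_weak_order (K : realDomainType) (T : finType) (s : T -> T -> K)
    (R E : rel T) (H : bicolored s R E) x z y :
  (forall a b c d, p4 R E a b c d ->
     spanning E R a c /\ s a b ^+ 2 = s a c ^+ 2) ->
  R x z -> spanning R E x z ->
  (s x y = s x z /\ spanning_pair R E x y) \/
  (s y z = s x z /\ spanning_pair R E y z).
Proof.
move=> HP Rxz sp.
have of_forced u v : forced R E x z u v ->
    s u v = s x z /\ spanning_pair R E u v.
  move=> F; split; first exact: forced_s F.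
  by left; split; [exact: forcedR F|exact: (spanning_forced H Rxz F)].
have /orP[Exy|nExy] := orbN (E x y); have /orP[Eyz|nEyz] := orbN (E y z).
- have Eyx : E y x by rewrite (symE H).
  have [b [c [d [P0 F sq]]]] := forced_p4 H Rxz sp Eyx Eyz.
  have [spE sqE] := HP _ _ _ _ P0.
  have H' := bicolored_swap H.
  have spyx := spanning_forced H' (forcedR Eyx F) (forced_sym H' Eyx F) spE.
  have F2 : forced E R y x y z := forced_r (forced_refl _ _ _ _) Eyz Rxz.
  have spyz := spanning_forced H' Eyx F2 spyx.
  have : s y x ^+ 2 == s x z ^+ 2 by rewrite -sq sqE (forced_s H' Eyx F).
  (* The sign of [s y x] decides which alternative holds. *)
  rewrite eqf_sqr => /orP[/eqP e|/eqP e].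
    by right; rewrite (forced_s H' Eyx F2); split=> //; right.
  left; rewrite (skew H) e opprK; split=> //; right; split=> //.
  exact: spanning_rev H' _ _ spyx.
- have /orP[Ryz|nRyz] := orbN (R y z).
    by right; apply: (of_forced y z (forced_l (forced_refl _ _ _ _) Ryz Exy)).
  have Rzx : R z x by rewrite (symR H).
  have Eyx : E y x by rewrite (symE H).
  have := norainbow H Rxz Exy; by rewrite (symR H) (negPf nRyz) (symE H) (negPf nEyz).
- have /orP[Rxy|nRxy] := orbN (R x y).
    have Ezy : E z y by rewrite (symE H).
    by left; apply: (of_forced x y (forced_r (forced_refl _ _ _ _) Rxy Ezy)).
  have Rzx : R z x by rewrite (symR H).
  have Ezy : E z y by rewrite (symE H).
  have := norainbow H Rzx Ezy; by rewrite (negPf nRxy) (negPf nExy).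
- by have [F|F] := forced_triangle H Rxz sp nExy nEyz; [left|right]; apply: (of_forced _ _ F).
Qed.

Theorem proper_clan (K : realDomainType) (T : finType) (s : T -> T -> K)
    (R E : rel T) (H : bicolored s R E) : (1 < #|[set: T]|)%N ->
  cut_connected R setT -> cut_connected E setT ->
  exists Y x y, [/\ s_clan s Y, Y != setT, x \in Y, y \in Y & R x y].
Proof.
move=> T1 conR conE; apply: contrapT => nex.
have min Y x y : s_clan s Y -> x \in Y -> y \in Y -> R x y -> Y = setT.
  move=> cY xY yY Rxy; apply/eqP/negPn/negP => YT; apply: nex.
  by exists Y, x, y.
have H' := bicolored_swap H.
have spanR a b c d : p4 R E a b c d -> spanning R E b a.
  move=> P k; apply: supportP; have Rba : R b a by case: P => [[Rab _ _] _]; rewrite (symR H).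
  rewrite (min _ b a (s_clan_support H P)) //.
    exact: in_supportl (forced_refl _ _ _ _).
  exact: in_supportr (forced_refl _ _ _ _).
(* This support also contains an R-pair, namely [a c], so the minimality statement applies to the
   colour E as well. *)
have spanE a b c d : p4 E R a b c d -> spanning E R b a.
  move=> P k; apply: supportP.
  have [[Eab Ebc Ecd] [Rac Rad Rbd]] := P.
  have F1 : forced E R b a b c := forced_r (forced_refl _ _ _ _) Ebc Rac.
  rewrite (min _ a c (s_clan_support H' P)) //.
    exact: in_supportr (forced_refl _ _ _ _).
  exact: in_supportr F1.
have p4s a b c d : p4 R E a b c d -> s a b ^+ 2 = s a c ^+ 2.
  by case=> [[Rab Rbc Rcd] [Eac Ead Ebd]]; exact: (p4_sqr H Rab Rbc Rcd Eac Ead Ebd).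
have [p1 [p2 [p3 [p5 P]]]] := exists_p4 H T1 conR conE.
pose L a : rel T := fun x y => `[< s x y = a /\ spanning_pair R E x y >].
(* The E-edges of the path lie in one forcing class: [d b] forces [d a], which forces [c a]. *)
have HPR a b c d : p4 R E a b c d -> spanning E R a c /\ s a b ^+ 2 = s a c ^+ 2.
  move=> P0; split; last exact: p4s P0.
  have [[Eab Ebc Ecd] [Rac Rad Rbd]] := p4_swap H P0.
  apply: (spanning_rev H').
  apply: (spanning_forced H' (_ : E d b) _ (spanE _ _ _ _ (p4_swap H P0))).
    by rewrite (symE H).
  apply: forced_l (forced_r (forced_refl _ _ _ _) Ebc Rac) _ Rbd.
  by rewrite (symE H).
have HPE a b c d : p4 E R a b c d -> spanning R E a c /\ s a b ^+ 2 = s a c ^+ 2.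
  move=> P0; split; last first.
    by case: P0 => [[Rab Rbc Rcd] [Eac Ead Ebd]]; exact: (p4_sqr H' Rab Rbc Rcd Eac Ead Ebd).
  have [[Eab Ebc Ecd] [Rac Rad Rbd]] := p4_swap H' P0.
  apply: (spanning_rev H).
  apply: (spanning_forced H (_ : R d b) _ (spanR _ _ _ _ (p4_swap H' P0))).
    by rewrite (symR H).
  apply: forced_l (forced_r (forced_refl _ _ _ _) Ebc Rac) _ Rbd.
  by rewrite (symR H).
have Lw a x z y : L a x z -> L a x y \/ L a y z.
  move=> /asboolP[sxz [[Rxz sp]|[Exz sp]]].
    have [[h1 h2]|[h1 h2]] := spanning_weak_order H y HPR Rxz sp; [left|right];
    by apply/asboolP; rewrite h1.
  have [[h1 h2]|[h1 h2]] := spanning_weak_order H' y HPE Exz sp; [left|right];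
    by apply/asboolP; rewrite h1; split=> //; case: h2; [right|left].
have Ls a x y : L a x y -> s x y = a by move=> /asboolP[].
(* The section of vertices not below [q] contains [q] and [r], since [s q q] and [s r q] differ from
   [a], but misses [p]: a proper clan with an R-pair. *)
have contra p q r a : a != 0 -> L a p q -> R q r -> L a q r -> False.
  move=> a0 Lpq Rqr Lqr.
  have cY := final_section_clan (q := q) (Ls a) (fun x z y => Lw a x z y).
  have nL u v : s u v = - a -> ~~ L a u v.
    move=> suv; apply/negP => /Ls; rewrite suv => /eqP.
    by rewrite -subr_eq0 -opprD oppr_eq0 -mulr2n mulrn_eq0 (negPf a0).
  have YT : [set k | ~~ L a k q] = setT.
    apply: (min _ q r cY _ _ Rqr); rewrite inE.
      by apply/negP => /Ls; rewrite (s_xx H) => /esym /eqP; rewrite (negPf a0).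
    by apply: nL; rewrite (skew H) (Ls _ _ _ Lqr).
  by have := in_setT p; rewrite -YT inE Lpq.
have [[R12 R23 R34] [E13 E14 E24]] := P.
have R21 : R p2 p1 by rewrite (symR H).
have R32 : R p3 p2 by rewrite (symR H).
have E31 : E p3 p1 by rewrite (symE H).
have sp21 := spanR _ _ _ _ P.
have sp12 := spanning_rev H sp21.
have [sp13 sq] := HPR _ _ _ _ P.
have s32 : s p3 p2 = s p1 p2.
  by rewrite (skew H) (skew H p1) (apexR H R21 R23 E13).
have sp32 : spanning R E p3 p2.
  apply: (spanning_rev H); apply: (spanning_forced H R21 _ sp21).
  exact: forced_r (forced_refl _ _ _ _) R23 E13.
have a0 := neq0R H R12.
(* According to the sign of [s p1 p3], the chain is [p1 p3 p2] or [p3 p1 p2]; its second pair is an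
   R-edge in both cases. *)
move/eqP: sq; rewrite eq_sym eqf_sqr => /orP[/eqP s13|/eqP s13].
- apply: (contra p1 p3 p2 _ a0) => //; apply/asboolP; split=> //; [by right|by left].
- apply: (contra p3 p1 p2 _ a0) => //; apply/asboolP; split=> //; last by left.
    by rewrite (skew H) s13 opprK.
  by right; split=> //; apply: spanning_rev H' _ _ sp13.
Qed.

(** * Clan inversion preserves principal minors *)

Section BlockDet.
Variables (p q : nat).

(** Schur complement with [\adj Q] replacing the inverse, which avoids division. The correction [N]
    is a multiple of the all-ones matrix, hence symmetric, so transposing [\det Q *: P - N] only
    transposes [P]. *)
Lemma det_block_const_neq0 (D : idomainType) (P : 'M[D]_p) (v : 'rV[D]_q)
    (w : 'cV[D]_q) (Q : 'M[D]_q) : \det Q != 0 ->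
  \det (block_mx P (const_mx 1 *m v) (w *m const_mx 1) Q) =
  \det (block_mx P^T (const_mx 1 *m v) (w *m const_mx 1) Q).
Proof.
move=> dQ; pose N : 'M[D]_p := const_mx 1 *m v *m \adj Q *m (w *m const_mx 1).
have NT : N^T = N.
  apply/matrixP => i j; rewrite mxE.
  suff E k l : N k l = (v *m \adj Q *m w) 0 0 by rewrite !E.
  rewrite /N -!mulmxA (mulmxA v) mulmxA mulmxA -(mulmxA (const_mx 1)) -(mulmxA v).
  rewrite -mulmxA mxE big_ord1 mxE mul1r mxE big_ord1 [X in _ * X]mxE mulr1.
  by rewrite mulmxA.
have schur (P0 : 'M[D]_p) :
    \det (block_mx P0 (const_mx 1 *m v) (w *m const_mx 1) Q) * \det Q ^+ p =
    \det (\det Q *: P0 - N) * \det Q.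
  have dF : \det (block_mx (\det Q)%:M 0 (- (\adj Q *m (w *m const_mx 1))) 1%:M : 'M_(p + q))
      = \det Q ^+ p by rewrite det_lblock det_scalar det1 mulr1.
  rewrite -(det_ublock _ (const_mx 1 *m v)) -dF -det_mulmx mulmx_block.
  rewrite !mulmxN !mulmx0 !mulmx1 !add0r mulmxA !(mulmxA Q) mul_mx_adj.
  by rewrite !mul_mx_scalar -mulmxA mul_scalar_mx subrr /N mulmxA.
apply: (mulIf (expf_neq0 p dQ)); rewrite !schur; congr (_ * _).
by rewrite -det_tr linearB /= linearZ /= NT.
Qed.

(** Replacing [Q] by [Q + 'X] makes its determinant nonzero. *)
Lemma det_block_const (D : idomainType) (P : 'M[D]_p) (v : 'rV[D]_q)
    (w : 'cV[D]_q) (Q : 'M[D]_q) :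
  \det (block_mx P (const_mx 1 *m v) (w *m const_mx 1) Q) =
  \det (block_mx P^T (const_mx 1 *m v) (w *m const_mx 1) Q).
Proof.
pose C m n (M : 'M[D]_(m, n)) := map_mx polyC M.
pose Q' := char_poly_mx (- Q).
have dQ' : \det Q' != 0 by exact/monic_neq0/char_poly_monic.
have ev m n (M : 'M[D]_(m, n)) : map_mx (horner_eval 0) (C _ _ M) = M.
  by apply/matrixP => i j; rewrite !mxE /horner_eval hornerC.
have evQ : map_mx (horner_eval 0) Q' = Q.
  apply/matrixP => i j; rewrite !mxE /horner_eval !hornerE hornerMn hornerX mul0rn.
  by rewrite sub0r opprK.
have e1 m n : map_mx (horner_eval 0) (const_mx 1 : 'M[{poly D}]_(m, n)) = const_mx 1.
  by apply/matrixP => i j; rewrite !mxE /horner_eval hornerC.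
have := congr1 (horner_eval 0)
  (det_block_const_neq0 (C _ _ P) (C _ _ v) (C _ _ w) dQ').
by rewrite -!det_map_mx !map_block_mx -!map_trmx !map_mxM /= !ev !e1 evQ.
Qed.

End BlockDet.

(** The equality [m = n] is a hypothesis because the sizes used are cardinals, only provably equal.
    The sign of the permutation enters twice and cancels. *)
Lemma det_mxsub_inj (K : comNzRingType) m n (g : 'I_m -> 'I_n) (N : 'M[K]_n) :
  m = n -> injective g -> \det (mxsub g g N) = \det N.
Proof.
move=> mn; subst m => ginj.
have -> : mxsub g g N = row_perm (perm ginj) (col_perm (perm ginj) N).
  by apply/matrixP => i j; rewrite !mxE !permE.
rewrite row_permE col_permE !det_mulmx !det_perm odd_permV mulrCA -signr_addb addbb.
by rewrite mulr1.
Qed.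

(** Listing [Y] before its complement gives a block matrix whose off-diagonal blocks have the form
    required by [det_block_const], since [Y] is a clan; inversion transposes the first block. *)
Lemma det_Inv (R : realType) n (A : 'M[R]_n) (Y : {set 'I_n}) :
  is_clan A Y -> \det (Inv A Y) = \det A.
Proof.
move=> cY; have [->|/set0Pn[y0 y0Y]] := eqVneq Y set0.
  by congr (\det _); apply/matrixP => i j; rewrite mxE inE.
pose f (k : 'I_(#|Y| + #|~: Y|)) : 'I_n :=
  match split k with inl i => enum_val i | inr j => enum_val j end.
have fl i : f (lshift _ i) = enum_val i by rewrite /f (unsplitK (inl i)).
have fr j : f (rshift _ j) = enum_val j by rewrite /f (unsplitK (inr j)).
have vl (i : 'I_#|Y|) : enum_val i \in Y := enum_valP i.
have vr (i : 'I_#|~: Y|) : (enum_val i \in Y) = false.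
  by have := enum_valP i; rewrite inE => /negPf.
have finj : injective f.
  move=> k l; rewrite -(splitK k) -(splitK l).
  case: (split k) => i; case: (split l) => j; rewrite /= ?fl ?fr.
  - by move=> /enum_val_inj ->.
  - by move=> e; have := vl i; rewrite e vr.
  - by move=> e; have := vl j; rewrite -e vr.
  - by move=> /enum_val_inj ->.
have card : (#|Y| + #|~: Y|)%N = n by rewrite cardsC card_ord.
rewrite -(det_mxsub_inj _ card finj) -[RHS](det_mxsub_inj _ card finj).
pose P : 'M[R]_#|Y| := \matrix_(i, j) A (enum_val i) (enum_val j).
pose Q : 'M[R]_#|~: Y| := \matrix_(i, j) A (enum_val i) (enum_val j).
pose v : 'rV[R]_#|~: Y| := \row_j A y0 (enum_val j).
pose w : 'cV[R]_#|~: Y| := \col_i A (enum_val i) y0.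
have blockE (M : 'M[R]_n) (P' : 'M[R]_#|Y|) :
    (forall i j, M (enum_val i) (enum_val j) = P' i j) ->
    (forall i j, ~~ ((i \in Y) && (j \in Y)) -> M i j = A i j) ->
    mxsub f f M = block_mx P' (const_mx 1 *m v) (w *m const_mx 1) Q.
  move=> MP MA; apply/matrixP => k l; rewrite mxE -(splitK k) -(splitK l).
  case: (split k) => i; case: (split l) => j; rewrite /= ?fl ?fr.
  - by rewrite block_mxEul MP.
  - rewrite block_mxEur MA ?vr ?andbF // mxE big_ord1 !mxE mul1r.
    by have [] := cY (enum_val i) y0 (enum_val j) (vl i) y0Y (negbT (vr j)).
  - rewrite block_mxEdl MA ?vr // mxE big_ord1 !mxE mulr1.
    by have [] := cY (enum_val j) y0 (enum_val i) (vl j) y0Y (negbT (vr i)).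
  - by rewrite block_mxEdr MA ?vr // mxE.
have eA : mxsub f f A = block_mx P (const_mx 1 *m v) (w *m const_mx 1) Q.
  by apply: blockE => // i j; rewrite mxE.
have eB : mxsub f f (Inv A Y) = block_mx P^T (const_mx 1 *m v) (w *m const_mx 1) Q.
  apply: blockE => i j; first by rewrite !mxE !vl.
  by move=> nij; rewrite mxE (negPf nij).
by rewrite eA eB [RHS]det_block_const.
Qed.

(** Inversion commutes with restriction to [X], and the trace of [Y] on [X] is a clan of the
    submatrix. *)
Lemma det_psubmx_Inv (R : realType) n (A : 'M[R]_n) (X Y : {set 'I_n}) :
  is_clan A Y -> \det (psubmx (Inv A Y) X) = \det (psubmx A X).
Proof.
move=> cY; pose Y' := [set i : 'I_#|X| | enum_val i \in Y].
rewrite -(@det_Inv _ _ (psubmx A X) Y').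
  by congr (\det _); apply/matrixP => i j; rewrite !mxE !inE.
move=> i j k; rewrite !inE => iY jY kY; rewrite !mxE; exact: cY.
Qed.

Lemma det_psubmx_seq (R : realType) n (M : 'M[R]_n) (s : seq 'I_n) x0 :
  uniq s -> \det (psubmx M [set x in s]) =
  \det (\matrix_(i < size s, j < size s) M (nth x0 s i) (nth x0 s j)).
Proof.
move=> us.
have lt (i : 'I_#|[set x in s]|) : (index (enum_val i) s < size s)%N.
  by rewrite index_mem; have := enum_valP i; rewrite inE.
rewrite -(@det_mxsub_inj _ _ _ (fun i => Ordinal (lt i))).
- congr (\det _); apply/matrixP => i j; rewrite !mxE /= !nth_index //.
    by have := enum_valP j; rewrite inE.
  by have := enum_valP i; rewrite inE.
- by rewrite cardsE; apply/card_uniqP.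
- move=> i j [] e; apply: enum_val_inj; rewrite -[LHS](@nth_index _ x0 _ s).
    by rewrite e nth_index //; have := enum_valP j; rewrite inE.
  by have := enum_valP i; rewrite inE.
Qed.

(** * Explicit determinants of orders 2 to 4 *)

(** Entries are a function on [nat], so that the expansion can be iterated and the indices
    computed. *)
Lemma det_matrixS (K : comNzRingType) m (a : nat -> nat -> K) :
  \det (\matrix_(i < m.+1, j < m.+1) a i j) =
  \sum_(j < m.+1) a 0%N j *
     ((-1) ^+ j * \det (\matrix_(i < m, k < m) a i.+1 (bump j k))).
Proof.
rewrite (expand_det_row _ ord0); apply: eq_bigr => j _; rewrite mxE; congr (_ * _).
rewrite /cofactor add0n; congr (_ * \det _).
by apply/matrixP => i k; rewrite !mxE.
Qed.

Lemma det_matrix2 (K : comNzRingType) (a : nat -> nat -> K) :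
  \det (\matrix_(i < 2, j < 2) a i j) = a 0%N 0%N * a 1%N 1%N - a 0%N 1%N * a 1%N 0%N.
Proof.
rewrite det_matrixS !big_ord_recl big_ord0 !det_mx11 !mxE /= /bump /=; ring.
Qed.

Lemma det_matrix3 (K : comNzRingType) (a : nat -> nat -> K) :
  \det (\matrix_(i < 3, j < 3) a i j) =
  a 0%N 0%N * (a 1%N 1%N * a 2%N 2%N - a 1%N 2%N * a 2%N 1%N)
  - a 0%N 1%N * (a 1%N 0%N * a 2%N 2%N - a 1%N 2%N * a 2%N 0%N)
  + a 0%N 2%N * (a 1%N 0%N * a 2%N 1%N - a 1%N 1%N * a 2%N 0%N).
Proof.
rewrite det_matrixS !big_ord_recl big_ord0 !(det_matrix2 (fun i j => a i.+1 (bump _ j))).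
rewrite /= /bump /=; ring.
Qed.

Lemma det_matrix4 (K : comNzRingType) (a : nat -> nat -> K) :
  let d3 j k l := a 1%N j * (a 2%N k * a 3%N l - a 2%N l * a 3%N k)
    - a 1%N k * (a 2%N j * a 3%N l - a 2%N l * a 3%N j)
    + a 1%N l * (a 2%N j * a 3%N k - a 2%N k * a 3%N j) in
  \det (\matrix_(i < 4, j < 4) a i j) =
  a 0%N 0%N * d3 1%N 2%N 3%N - a 0%N 1%N * d3 0%N 2%N 3%N
  + a 0%N 2%N * d3 0%N 1%N 3%N - a 0%N 3%N * d3 0%N 1%N 2%N.
Proof.
rewrite det_matrixS !big_ord_recl big_ord0 !(det_matrix3 (fun i j => a i.+1 (bump _ j))).
rewrite /= /bump /=; ring.
Qed.

(** * From small principal minors to the two colours *)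

Lemma gen_tournament_diag (R : realType) n (A : 'M[R]_n) i :
  gen_tournament A -> A i i = 0.
Proof.
case=> _ /matrixP /(_ i i); rewrite !mxE eqxx subrr => /eqP.
by rewrite -mulr2n mulrn_eq0 => /eqP.
Qed.

Lemma gen_tournamentC (R : realType) n (A : 'M[R]_n) i j :
  gen_tournament A -> i != j -> A j i = 1 - A i j.
Proof.
case=> _ /matrixP /(_ i j) + /negPf nij; rewrite !mxE nij subr0 => <-.
by rewrite addrC addrK.
Qed.

Definition skew_part (R : realType) n (A : 'M[R]_n) i j := A i j - A j i.

Definition reversed (R : realType) n (A B : 'M[R]_n) : rel 'I_n :=
  fun i j => (A i j != A j i) && (B i j == A j i).

Definition unreversed (R : realType) n (A B : 'M[R]_n) : rel 'I_n :=
  fun i j => (A i j != A j i) && (B i j == A i j).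

Definition same_small_minors (R : realType) n (A B : 'M[R]_n) :=
  forall X : {set 'I_n}, (1 <= #|X| <= 4)%N ->
    \det (psubmx A X) = \det (psubmx B X).

Lemma small_minor (R : realType) n (A B : 'M[R]_n) (s : seq 'I_n) x0 :
  same_small_minors A B -> uniq s -> (1 <= size s <= 4)%N ->
  \det (\matrix_(i < size s, j < size s) A (nth x0 s i) (nth x0 s j)) =
  \det (\matrix_(i < size s, j < size s) B (nth x0 s i) (nth x0 s j)).
Proof.
move=> AB us sz; rewrite -!det_psubmx_seq //; apply: AB.
by rewrite cardsE; move/card_uniqP: us => ->.
Qed.

Section Colors.
Variables (R : realType) (n : nat) (A B : 'M[R]_n).
Hypotheses (hA : gen_tournament A) (hB : gen_tournament B).
Hypothesis AB : same_small_minors A B.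

Lemma minor2 x y : B x y = A x y \/ B x y = A y x.
Proof.
have [<-|xy] := eqVneq x y; first by left; rewrite !gen_tournament_diag.
have := small_minor (s := [:: x; y]) x AB; rewrite /= inE xy => /(_ isT isT).
rewrite (det_matrix2 (fun i j => A (nth x [:: x; y] i) (nth x [:: x; y] j))).
rewrite (det_matrix2 (fun i j => B (nth x [:: x; y] i) (nth x [:: x; y] j))) /=.
rewrite !(gen_tournament_diag _ hA) !(gen_tournament_diag _ hB).
rewrite (gen_tournamentC hA xy) (gen_tournamentC hB xy) => e.
have : (B x y - A x y) * (B x y - (1 - A x y)) = 0.
  transitivity ((0 * 0 - B x y * (1 - B x y)) - (0 * 0 - A x y * (1 - A x y))); first by ring.
  by rewrite e subrr.
by move/eqP; rewrite mulf_eq0 !subr_eq0 => /orP[/eqP|/eqP]; [left|right].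
Qed.

(** With a zero diagonal, only the two 3-cycles contribute to the determinant. *)
Lemma minor3 x y z : x != y -> x != z -> y != z ->
  A x y * A y z * (1 - A x z) + A x z * (1 - A y z) * (1 - A x y) =
  B x y * B y z * (1 - B x z) + B x z * (1 - B y z) * (1 - B x y).
Proof.
move=> xy xz yz.
have := small_minor (s := [:: x; y; z]) x AB.
rewrite /= !inE negb_or xy xz yz => /(_ isT isT).
rewrite (det_matrix3 (fun i j => A (nth x [:: x; y; z] i) (nth x [:: x; y; z] j))).
rewrite (det_matrix3 (fun i j => B (nth x [:: x; y; z] i) (nth x [:: x; y; z] j))) /=.
rewrite !(gen_tournament_diag _ hA) !(gen_tournament_diag _ hB).
rewrite !(gen_tournamentC hA xy) !(gen_tournamentC hB xy).
rewrite !(gen_tournamentC hA xz) !(gen_tournamentC hB xz).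
rewrite !(gen_tournamentC hA yz) !(gen_tournamentC hB yz) => e.
by lra.
Qed.

Lemma reversedP x y : reversed A B x y ->
  [/\ x != y, A x y != 1 - A x y, A y x = 1 - A x y & B x y = 1 - A x y].
Proof.
move=> /andP[nA /eqP ->].
have xy : x != y by apply: contraNneq nA => ->.
by rewrite (gen_tournamentC hA xy) in nA *.
Qed.

Lemma unreversedP x y : unreversed A B x y ->
  [/\ x != y, A x y != 1 - A x y, A y x = 1 - A x y & B x y = A x y].
Proof.
move=> /andP[nA /eqP ->].
have xy : x != y by apply: contraNneq nA => ->.
by rewrite (gen_tournamentC hA xy) in nA *.
Qed.

Lemma uncoloredP x y : ~~ reversed A B x y -> ~~ unreversed A B x y ->
  A x y = A y x.
Proof.
rewrite /reversed /unreversed; have [//|nA] := eqVneq (A x y).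
by case: (minor2 x y) => ->; rewrite eqxx.
Qed.

Lemma double_sub1_neq0 (p : R) : p != 1 - p -> 2 * p - 1 != 0.
Proof. by apply: contra => /eqP e; apply/eqP; lra. Qed.

Lemma reversed_sym : symmetric (reversed A B).
Proof.
move=> x y; have [->//|xy] := eqVneq x y.
rewrite /reversed (gen_tournamentC hB xy) (gen_tournamentC hA xy).
by rewrite eq_sym; congr (_ && _); apply/eqP/eqP; lra.
Qed.

Lemma unreversed_sym : symmetric (unreversed A B).
Proof.
move=> x y; have [->//|xy] := eqVneq x y.
rewrite /unreversed (gen_tournamentC hB xy) (gen_tournamentC hA xy).
by rewrite eq_sym; congr (_ && _); apply/eqP/eqP; lra.
Qed.

(** The identity of order 3 factors as below, and [A y z] is not 1/2 because [y z] is coloured. *)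
Lemma reversed_apex x y z : reversed A B x y -> reversed A B x z ->
  unreversed A B y z -> A x y = A x z.
Proof.
move=> /reversedP[xy nxy Ayx Bxy] /reversedP[xz nxz Azx Bxz] /unreversedP[yz nyz _ Byz].
have := minor3 xy xz yz; rewrite Bxy Bxz Byz => e.
have : (A x y - A x z) * (2 * A y z - 1) == 0 by apply/eqP; lra.
by rewrite mulf_eq0 (negPf (double_sub1_neq0 nyz)) orbF subr_eq0 => /eqP.
Qed.

Lemma unreversed_apex x y z : unreversed A B x y -> unreversed A B x z ->
  reversed A B y z -> A x y = A x z.
Proof.
move=> /unreversedP[xy nxy Ayx Bxy] /unreversedP[xz nxz Azx Bxz] /reversedP[yz nyz _ Byz].
have := minor3 xy xz yz; rewrite Bxy Bxz Byz => e.
have : (A x y - A x z) * (2 * A y z - 1) == 0 by apply/eqP; lra.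
by rewrite mulf_eq0 (negPf (double_sub1_neq0 nyz)) orbF subr_eq0 => /eqP.
Qed.

(** The apex relations express all entries by [A x y] and [A x z]; the minors of order 4 then give a
    product whose first two factors are nonzero. *)
Lemma minor4_p4 x y z t : p4 (reversed A B) (unreversed A B) x y z t ->
  skew_part A x y ^+ 2 = skew_part A x z ^+ 2.
Proof.
case=> [[Rxy Ryz Rzt] [Exz Ext Eyt]].
have [xy nxy Ayx Bxy] := reversedP Rxy; have [yz _ Azy Byz] := reversedP Ryz.
have [zt _ Atz Bzt] := reversedP Rzt; have [xz nxz Azx Bxz] := unreversedP Exz.
have [xt _ Atx Bxt] := unreversedP Ext; have [yt _ Aty Byt] := unreversedP Eyt.
have Ayz : A y z = 1 - A x y by rewrite -Ayx; apply/esym/reversed_apex; rewrite // reversed_sym.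
have Azt : A z t = A x y.
  rewrite -(@reversed_apex z y t) // 1?reversed_sym //; lra.
have Axt : A x t = A x z by apply/esym/unreversed_apex.
have Ayt : A y t = A x z.
  have : A t x = A t y by apply: unreversed_apex => //; rewrite unreversed_sym.
  lra.
have := small_minor (s := [:: x; y; z; t]) x AB.
rewrite /= !inE !negb_or xy xz xt yz yt zt => /(_ isT isT).
rewrite (det_matrix4 (fun i j => A (nth x [:: x; y; z; t] i) (nth x [:: x; y; z; t] j))).
rewrite (det_matrix4 (fun i j => B (nth x [:: x; y; z; t] i) (nth x [:: x; y; z; t] j))) /=.
rewrite !(gen_tournament_diag _ hA) !(gen_tournament_diag _ hB).
rewrite !(gen_tournamentC hB xy) !(gen_tournamentC hB xz) !(gen_tournamentC hB xt).
rewrite !(gen_tournamentC hB yz) !(gen_tournamentC hB yt) !(gen_tournamentC hB zt).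
rewrite Bxy Byz Bzt Bxz Bxt Byt Ayx Azy Atz Azx Atx Aty Ayz Azt Axt Ayt => e.
have : (2 * A x y - 1) * (2 * A x z - 1) *
    ((2 * A x y - 1) ^+ 2 - (2 * A x z - 1) ^+ 2) == 0 by apply/eqP; lra.
rewrite !mulf_eq0 (negPf (double_sub1_neq0 nxy)) (negPf (double_sub1_neq0 nxz)) subr_eq0 => /eqP e2.
rewrite /skew_part Ayx Azx; lra.
Qed.

Lemma bicolored_minors :
  bicolored (skew_part A) (reversed A B) (unreversed A B).
Proof.
split.
- by move=> x y; rewrite /skew_part opprB.
- exact: reversed_sym.
- exact: unreversed_sym.
- move=> x y /andP[nA /eqP e]; rewrite /unreversed nA e /= eq_sym; exact: nA.
- by move=> x y /andP[nA _]; rewrite subr_eq0.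
- by move=> x y /andP[nA _]; rewrite subr_eq0.
- by move=> x y nR nE; rewrite /skew_part (uncoloredP nR nE) subrr.
- move=> x y z Rxy Exz; apply/negPn/negP => /norP[nR nE].
  have Ayz := uncoloredP nR nE.
  have [xy nxy _ Bxy] := reversedP Rxy.
  have [xz nxz _ Bxz] := unreversedP Exz.
  have yz : y != z.
    by apply: contraNneq nxy => yz; rewrite -Bxy yz Bxz.
  have Byz : B y z = A y z by case: (minor2 y z) => ->; rewrite ?Ayz.
  have := minor3 xy xz yz; rewrite Bxy Bxz Byz => e.
  (* An uncoloured pair has entry 1/2, so the identity of order 3 reduces to a product of nonzero
     factors. *)
  have e2 : A y z = 1 - A y z by rewrite {1}Ayz (gen_tournamentC hA yz).
  have : (2 * A x y - 1) * (2 * A x z - 1) == 0 by apply/eqP; nra.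
  by rewrite mulf_eq0 (negPf (double_sub1_neq0 nxy)) (negPf (double_sub1_neq0 nxz)).
- move=> x y z Rxy Rxz Eyz; rewrite /skew_part (reversed_apex Rxy Rxz Eyz).
  by have [_ _ -> _] := reversedP Rxy; have [_ _ -> _] := reversedP Rxz;
    rewrite (reversed_apex Rxy Rxz Eyz).
- move=> x y z Exy Exz Ryz; rewrite /skew_part (unreversed_apex Exy Exz Ryz).
  by have [_ _ -> _] := unreversedP Exy; have [_ _ -> _] := unreversedP Exz;
    rewrite (unreversed_apex Exy Exz Ryz).
- by move=> x y z t Rxy Ryz Rzt Exz Ext Eyt; apply: (@minor4_p4 x y z t).
Qed.

End Colors.

(** * Smaller clans inside a given clan *)

Section ProperClan.
Variables (K : realDomainType) (T : finType) (s : T -> T -> K) (R E : rel T).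
Hypothesis H : bicolored s R E.
Variable X : {set T}.
Hypothesis cX : s_clan s X.

(** A clan of the restriction of [s] to the clan [X] is a clan of [s], so [proper_clan] is applied
    on the subtype of elements of [X]. *)
Lemma proper_clan_in : (1 < #|X|)%N -> cut_connected R X -> cut_connected E X ->
  exists Y x y, [/\ s_clan s Y, Y \proper X, x \in Y, y \in Y & R x y].
Proof.
move=> X1 conR conE; pose S := {x : T | x \in X}.
have restr (Q : rel T) : cut_connected Q X ->
    cut_connected (fun x y : S => Q (val x) (val y)) setT.
  move=> conQ U _ /set0Pn[u uU] UT.
  have [||| x [y [/imsetP[x' x'U ->]]]] := conQ (val @: U).
  - by apply/subsetP => _ /imsetP[x _ ->]; exact: valP.
  - by apply/set0Pn; exists (val u); apply: imset_f.
  - apply: contra UT => /eqP UX; apply/eqP/setP => x; rewrite inE.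
    have : val x \in val @: U by rewrite UX; exact: valP.
    by move=> /imsetP[x' x'U /val_inj ->].
  rewrite inE => /andP[yU yX] Qxy; exists x', (Sub y yX : S); split=> //.
  rewrite !inE andbT; apply: contra yU => yU; apply/imsetP.
  by exists (Sub y yX : S).
have H' : bicolored (fun x y : S => s (val x) (val y))
    (fun x y : S => R (val x) (val y)) (fun x y : S => E (val x) (val y)).
  case: H => h1 h2 h3 h4 h5 h6 h7 h8 h9 h10 h11.
  split=> x y; [exact: h1|exact: h2|exact: h3|exact: h4|exact: h5|exact: h6|exact: h7|..].
  - by move=> z; apply: h8.
  - by move=> z; apply: h9.
  - by move=> z; apply: h10.
  - by move=> z t; apply: h11.
have S1 : (1 < #|[set: S]|)%N by rewrite cardsT card_sig.
have [Y [x [y [cY YT xY yY Rxy]]]] := proper_clan H' S1 (restr _ conR) (restr _ conE).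
exists (val @: Y), (val x), (val y); split; rewrite ?imset_f //.
  move=> k u v kY /imsetP[u' u'Y ->] /imsetP[v' v'Y ->].
  have [kX|kX] := boolP (k \in X); last by apply: cX => //; exact: valP.
  apply: (cY (Sub k kX : S)) => //; apply: contra kY => kY.
  by apply/imsetP; exists (Sub k kX : S).
rewrite properE; apply/andP; split.
  by apply/subsetP => _ /imsetP[u _ ->]; exact: valP.
apply: contra YT => /subsetP sXY; apply/eqP/setP => u; rewrite inE.
by have /imsetP[u' u'Y /val_inj ->] := sXY _ (valP u).
Qed.

(** [Y] is the R-component of [x] in [X], obtained as a smallest R-closed subset containing [x].
    Vertices of [X] outside it send it no R-edge, so [cut_connected_const] applies; for the others
    [X] is a clan. *)
Lemma proper_clan_disconnected x y : x \in X -> y \in X -> R x y ->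
  ~ cut_connected R X ->
  exists Y x y, [/\ s_clan s Y, Y \proper X, x \in Y, y \in Y & R x y].
Proof.
move=> xX yX Rxy /existsNP[U] /not_implyP[sU] /not_implyP[U0] /not_implyP[UX /forallNP nex].
pose closed (Y : {set T}) := [forall a in Y, forall b in X :\: Y, ~~ R a b].
have closedC (Y : {set T}) : Y \subset X -> closed Y -> closed (X :\: Y).
  move=> sY /forall_inP cY; apply/forall_inP => a aY; apply/forall_inP => b.
  rewrite setDDr setDv set0U => /setIP[_ bY].
  by rewrite (symR H); have /forall_inP := cY _ bY; apply.
have cU : closed U.
  apply/forall_inP => a aU; apply/forall_inP => b bU; apply/negP => Rab.
  by apply: (nex a); exists b.
pose P (Y : {set T}) := [&& Y \subset X, x \in Y & closed Y].
(* Whichever of [U] and its complement in [X] contains [x] bounds the minimal set away from [X]. *)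
have [V PV VX] : exists2 V, P V & V != X.
  have [xU|xU] := boolP (x \in U); first by exists U => //; rewrite /P sU xU.
  exists (X :\: U); first by rewrite /P subsetDl closedC // !inE xU xX.
  apply: contra U0 => /eqP e; apply/eqP/setP => u; rewrite inE; apply/negP => uU.
  by have := subsetP sU u uU; rewrite -e inE uU.
case: (arg_minnP (fun Y : {set T} => #|Y|) PV) => Y /and3P[sY xY cY] minY.
have YX : Y \proper X.
  rewrite properEcard sY (leq_ltn_trans (minY _ PV)) //.
  by apply: proper_card; rewrite properEneq VX; case/and3P: PV.
have cutY a b : a \in Y -> b \in X -> b \notin Y -> ~~ R a b.
  move=> aY bX bY; have /forall_inP := forall_inP cY _ aY.
  by apply; rewrite inE bY.
have conY : cut_connected R Y.
  move=> Z sZ Z0 ZY; apply: contrapT => /forallNP nexZ.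
  have nR a b : a \in Z -> b \in Y -> b \notin Z -> ~~ R a b.
    move=> aZ bY bZ; apply/negP => Rab; apply: (nexZ a); exists b.
    by rewrite inE bZ bY.
  have ltZ (Z' : {set T}) : Z' \subset Y -> Z' != Y -> x \in Z' -> closed Z' -> False.
    move=> sZ' nZ' xZ' cZ'; have := proper_card (_ : Z' \proper Y).
    rewrite properEneq nZ' sZ' ltnNge minY; first by move=> /(_ isT).
    by rewrite /P xZ' cZ' (subset_trans sZ').
  have [xZ|xZ] := boolP (x \in Z).
    apply: (ltZ Z) => //; apply/forall_inP => a aZ; apply/forall_inP => b.
    rewrite inE => /andP[bZ bX]; have [bY|bY] := boolP (b \in Y); first exact: nR.
    exact: cutY (subsetP sZ _ aZ) bX bY.
  apply: (ltZ (Y :\: Z)); rewrite ?subsetDl ?inE ?xZ //.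
    apply: contra Z0 => /eqP e; apply/eqP/setP => u; rewrite inE; apply/negP => uZ.
    by have := subsetP sZ u uZ; rewrite -e inE uZ.
  apply/forall_inP => a; rewrite inE => /andP[aZ aY]; apply/forall_inP => b.
  rewrite !inE negb_and negbK => /andP[+ bX]; have [bY|bY _] := boolP (b \in Y).
    by rewrite orbF => bZ; rewrite (symR H); apply: nR.
  exact: cutY aY bX bY.
exists Y, x, y; split=> //.
  move=> k u v kY uY vY; have [kX|kX] := boolP (k \in X); last first.
    by apply: cX => //; exact: (subsetP sY).
  apply: (cut_connected_const H conY _ uY vY) => w wY.
  by rewrite (symR H); apply: cutY.
by apply/negPn/negP => yY; have := cutY _ _ xY yX yY; rewrite Rxy.
Qed.

End ProperClan.

(** * Reaching [B] by successive clan inversions *)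

Lemma cut_connected_sub (T : finType) (R R' : rel T) (X : {set T}) :
  {in X &, forall x y, R x y -> R' x y} -> cut_connected R X -> cut_connected R' X.
Proof.
move=> RR' con U sU U0 UX; have [x [y [xU yU Rxy]]] := con U sU U0 UX.
exists x, y; split=> //; apply: RR' => //; first exact: (subsetP sU).
by move: yU; rewrite inE => /andP[].
Qed.

Inductive inv_reach (R : realType) n : 'M[R]_n -> 'M[R]_n -> Prop :=
| inv_reach_refl A : inv_reach A A
| inv_reach_step A Y B : is_clan A Y -> inv_reach (Inv A Y) B -> inv_reach A B.

Definition agree_off (R : realType) n (X : {set 'I_n}) (A B : 'M[R]_n) :=
  forall i j, ~~ ((i \in X) && (j \in X)) -> A i j = B i j.

Section Reach.
Variables (R : realType) (n : nat).
Implicit Types (A B C : 'M[R]_n) (X Y : {set 'I_n}).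

Lemma inv_reach_trans A B C : inv_reach A B -> inv_reach B C -> inv_reach A C.
Proof. by elim=> // {}A Y {}B cY _ IH /IH; apply: inv_reach_step. Qed.

Lemma gen_tournament_Inv A Y : gen_tournament A -> gen_tournament (Inv A Y).
Proof.
case=> A0 /matrixP AJ; split=> [i j|]; first by rewrite mxE; case: ifP.
apply/matrixP => i j; rewrite -AJ !mxE andbC; case: ifP => // _; exact: addrC.
Qed.

Lemma gen_tournament_reach A B : inv_reach A B -> gen_tournament A -> gen_tournament B.
Proof. by elim=> // {}A Y {}B _ _ IH gA; apply: IH; apply: gen_tournament_Inv. Qed.

Lemma det_reach A B X : inv_reach A B -> \det (psubmx A X) = \det (psubmx B X).
Proof. by elim=> // {}A Y {}B cY _ <-; rewrite det_psubmx_Inv. Qed.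

Lemma is_clan_agree_off X A B : agree_off X A B -> is_clan B X -> is_clan A X.
Proof.
move=> AB cX i j k iX jX kX.
by rewrite !AB ?iX ?jX ?(negPf kX) //; apply: cX.
Qed.

(** Off the diagonal, an entry is determined by the skew part, as half of one plus its value. *)
Lemma s_clanP A X : gen_tournament A -> is_clan A X <-> s_clan (skew_part A) X.
Proof.
move=> gA; split=> cX.
  by move=> k x y kX xX yX; rewrite /skew_part; have [-> ->] := cX x y k xX yX kX.
move=> i j k iX jX kX; have := cX k i j kX iX jX; rewrite /skew_part.
have ik : i != k by apply: contraNneq kX => <-.
have jk : j != k by apply: contraNneq kX => <-.
rewrite (gen_tournamentC gA ik) (gen_tournamentC gA jk) => e.
by have -> : A i k = A j k by lra.
Qed.

Definition nb_reversed A B X :=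
  #|[set p | [&& p.1 \in X, p.2 \in X & reversed A B p.1 p.2]]|.

Lemma agree_reversed0 A B X : gen_tournament A -> gen_tournament B ->
  same_small_minors A B -> (forall x y, x \in X -> y \in X -> ~~ reversed A B x y) ->
  {in X &, A =2 B}.
Proof.
move=> gA gB AB nR x y xX yX; have := nR x y xX yX; rewrite /reversed.
case: (minor2 gA gB AB x y) => ->; first by [].
by rewrite eqxx andbT negbK => /eqP.
Qed.

(** Decrease of the induction measure: no pair inside [Y] stays reversed, in particular not [x y],
    and the other pairs keep their status. *)
Lemma nb_reversed_agree A B C X Y x y : Y \subset X -> agree_off Y C A ->
  {in Y &, C =2 B} -> x \in Y -> y \in Y -> reversed A B x y ->
  (forall i j, reversed C B i j -> reversed A B i j) /\
  (nb_reversed C B X < nb_reversed A B X)%N.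
Proof.
move=> sY CA CB xY yY Rxy.
have nC i j : i \in Y -> j \in Y -> ~~ reversed C B i j.
  by move=> iY jY; rewrite /reversed -(CB _ _ iY jY); case: eqVneq.
have sub i j : reversed C B i j -> reversed A B i j.
  have [/andP[iY jY]|nij] := boolP ((i \in Y) && (j \in Y)).
    by rewrite (negPf (nC _ _ iY jY)).
  by rewrite /reversed !CA // andbC.
split=> //; apply: proper_card; apply/properP; split.
  by apply/subsetP => p; rewrite !inE => /and3P[-> -> /sub].
exists (x, y); rewrite !inE /= ?Rxy ?(negPf (nC _ _ xY yY)) ?andbF //.
by rewrite !(subsetP sY).
Qed.

(** Outer induction on the size of [X], inner induction on the number of reversed pairs in [X]. *)
Lemma reach_on B X A : gen_tournament B -> gen_tournament A ->
  same_small_minors A B -> is_clan A X ->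
  exists C, [/\ inv_reach A C, agree_off X C A & {in X &, C =2 B}].
Proof.
move=> gB; have [N] := ubnP #|X|; elim: N X A => // N IHN X A; rewrite ltnS => XN.
(* The outer hypothesis makes the matrix agree with [B] on a proper subclan containing a reversed
   pair. *)
have step A0 : gen_tournament A0 -> same_small_minors A0 B ->
    is_clan A0 X -> (exists Y x y, [/\ s_clan (skew_part A0) Y, Y \proper X,
       x \in Y, y \in Y & reversed A0 B x y]) ->
    exists A1, [/\ inv_reach A0 A1, agree_off X A1 A0,
      [/\ gen_tournament A1, same_small_minors A1 B & is_clan A1 X],
      forall i j, reversed A1 B i j -> reversed A0 B i j &
      (nb_reversed A1 B X < nb_reversed A0 B X)%N].
  move=> gA AB cX [Y [x [y [/(s_clanP _ gA) cY YX xY yY Rxy]]]].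
  have sY := proper_sub YX.
  have [A1 [r off on]] := IHN Y A0 (leq_trans (proper_card YX) XN) gA AB cY.
  have [sub lt] := nb_reversed_agree sY off on xY yY Rxy.
  have offX : agree_off X A1 A0.
    move=> i j nij; apply: off; apply: contra nij => /andP[iY jY].
    by rewrite !(subsetP sY).
  exists A1; split=> //; split; first exact: gen_tournament_reach gA.
    by move=> Z Z4; rewrite -(det_reach Z r) AB.
  exact: is_clan_agree_off cX.
have agreed A0 : gen_tournament A0 -> same_small_minors A0 B ->
    ~ (exists x y, [/\ x \in X, y \in X & reversed A0 B x y]) ->
    exists C, [/\ inv_reach A0 C, agree_off X C A0 & {in X &, C =2 B}].
  move=> gA AB nex; exists A0; split=> //; first exact: inv_reach_refl.
  apply: agree_reversed0 => // x y xX yX; apply/negP => Rxy; apply: nex.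
  by exists x, y.
(* Reversed pairs only disappear, so R stays disconnected on [X] and the step can be repeated. *)
have disc A0 : gen_tournament A0 -> same_small_minors A0 B -> is_clan A0 X ->
    ~ cut_connected (reversed A0 B) X ->
    exists C, [/\ inv_reach A0 C, agree_off X C A0 & {in X &, C =2 B}].
  have [m] := ubnP (nb_reversed A0 B X); elim: m A0 => // m IH A0; rewrite ltnS => Am.
  move=> gA AB cX ncon.
  have [[x [y [xX yX Rxy]]]|] :=
    pselect (exists x y, [/\ x \in X, y \in X & reversed A0 B x y]); last exact: agreed.
  have ex := proper_clan_disconnected (bicolored_minors gA gB AB)
    ((s_clanP X gA).1 cX) xX yX Rxy ncon.
  have [A1 [r off [gA1 AB1 cX1] sub lt]] := step A0 gA AB cX ex.
  have [|C [r' off' on]] := IH A1 (leq_trans lt Am) gA1 AB1 cX1.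
    by move=> con; apply: ncon; apply: cut_connected_sub con => i j _ _; apply: sub.
  by exists C; split=> // [|i j nij]; [exact: inv_reach_trans r'|rewrite off' // off].
have [m] := ubnP (nb_reversed A B X); elim: m A => // m IH A; rewrite ltnS => Am.
move=> gA AB cX.
have [[x [y [xX yX Rxy]]]|] :=
    pselect (exists x y, [/\ x \in X, y \in X & reversed A B x y]); last exact: agreed.
have [conR|] := pselect (cut_connected (reversed A B) X); last exact: disc.
have offInv : agree_off X (Inv A X) A by move=> i j nij; rewrite mxE (negPf nij).
(* Inverting [X] exchanges the colours inside [X], which reduces to the disconnected case. *)
have [conE|nconE] := pselect (cut_connected (unreversed A B) X); last first.
  have [||||C [r off on]] := disc (Inv A X).
  - exact: gen_tournament_Inv.
  - by move=> Z Z4; rewrite det_psubmx_Inv // AB.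
  - exact: is_clan_agree_off cX.
  - move=> con; apply: nconE; apply: cut_connected_sub con => i j iX jX.
    by rewrite /reversed /unreversed !mxE iX jX /= eq_sym.
  exists C; split=> //; first exact: inv_reach_step r.
  by move=> i j nij; rewrite off // offInv.
have X1 : (1 < #|X|)%N.
  by apply/card_gt1P; exists x, y; split=> //; have [] := reversedP gA Rxy.
have ex := proper_clan_in (bicolored_minors gA gB AB) ((s_clanP X gA).1 cX) X1 conR conE.
have [A1 [r off [gA1 AB1 cX1] sub lt]] := step A gA AB cX ex.
have [C [r' off' on]] := IH A1 (leq_trans lt Am) gA1 AB1 cX1.
by exists C; split=> // [|i j nij]; [exact: inv_reach_trans r'|rewrite off' // off].
Qed.

Lemma inv_reach_seq A B : inv_reach A B -> gen_tournament A ->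
  exists (m : nat) (As : nat -> 'M[R]_n) (Xs : nat -> {set 'I_n}),
      As 0%N = A /\ As m = B /\
      (forall k, (k <= m)%N -> gen_tournament (As k)) /\
      (forall k, (k < m)%N ->
         is_clan (As k) (Xs k) /\ As k.+1 = Inv (As k) (Xs k)).
Proof.
elim=> [{}A gA|{}A Y {}B cY _ IH gA].
  by exists 0%N, (fun=> A), (fun=> set0); split=> //; split=> //; split.
have [m [As [Xs [A0 [Am [gAs st]]]]]] := IH (gen_tournament_Inv Y gA).
exists m.+1, (fun k => if k is k'.+1 then As k' else A),
  (fun k => if k is k'.+1 then Xs k' else Y).
split=> //; split=> //; split=> [[|k] //|[|k]]; [exact: gAs|by rewrite A0|exact: st].
Qed.

End Reach.

Theorem theorem2p4 (R : realType) (n : nat) (hn : (0 < n)%N)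
  (A B : 'M[R]_n) (hA : gen_tournament A) (hB : gen_tournament B) :
  ((forall X : {set 'I_n}, (1 <= #|X| <= 4)%N ->
      \det (psubmx A X) = \det (psubmx B X)) <->
   (forall X : {set 'I_n}, (1 <= #|X|)%N ->
      \det (psubmx A X) = \det (psubmx B X)))
  /\
  ((forall X : {set 'I_n}, (1 <= #|X|)%N ->
      \det (psubmx A X) = \det (psubmx B X)) <->
   (exists (m : nat) (As : nat -> 'M[R]_n) (Xs : nat -> {set 'I_n}),
      As 0%N = A /\ As m = B /\
      (forall k, (k <= m)%N -> gen_tournament (As k)) /\
      (forall k, (k < m)%N ->
         is_clan (As k) (Xs k) /\ As k.+1 = Inv (As k) (Xs k)))).
Proof.
have reach : same_small_minors A B -> inv_reach A B.
  (* The full set is vacuously a clan, and agreement on it is equality of matrices. *)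
  move=> AB; have [|C [r _ on]] := reach_on hB hA AB (X := setT).
    by move=> i j k _ _; rewrite inE.
  suff <- : C = B by [].
  by apply/matrixP => i j; apply: on; rewrite inE.
have small : (forall X : {set 'I_n}, (1 <= #|X|)%N ->
    \det (psubmx A X) = \det (psubmx B X)) -> same_small_minors A B.
  by move=> AB X /andP[X1 _]; apply: AB.
split; split.
- by move=> /reach r X _; apply: det_reach.
- exact: small.
- by move=> /small/reach r; apply: inv_reach_seq.
- move=> [m [As [Xs [<- [<- [_ st]]]]]] X _.
  elim: m st => // m IH st; rewrite IH; last by move=> k km; apply: st; rewrite ltnW.
  by have [cX ->] := st m (ltnSn m); rewrite det_psubmx_Inv.
Qed.
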